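(* Let $F_d({\mathfrak A}^2)$ be the free metabelian Lie algebra of rank $d$ over $K$ and let $G$ be a subgroup of $GL_d(K)$. If $(KX_d)^G=0$ and $\dim_K F_d({\mathfrak A}^2)^G=\infty$, then the algebra $F_d({\mathfrak V})^G$ is not finitely generated (as a $K$-algebra) for any variety $\mathfrak V$ containing $\mathfrak L$.
   Context: $K$ is a field of characteristic $0$, $d\ge 2$ is an integer, and algebras are $K$-algebras, not necessarily associative or unital. A variety is the class of all algebras satisfying a given set of polynomial identities (elements of the absolutely free nonassociative algebra $K\{x_1,x_2,\ldots\}$). For a variety $\mathfrak V$, $F_d(\mathfrak V)$ is the relatively free algebra of $\mathfrak V$ of rank $d$, freely generated by $X_d=\{x_1,\ldots,x_d\}$, i.e. $K\{x_1,\ldots,x_d\}$ (without constant terms) modulo the polynomial identities of $\mathfrak V$ in $x_1,\ldots,x_d$. $\mathfrak L$ is the variety of algebras defined by the right-symmetric identity $(x_1,x_2,x_3)=(x_1,x_3,x_2)$, where $(x_1,x_2,x_3)=x_1(x_2x_3)-(x_1x_2)x_3$, together with $x_1(x_2x_3)=0$. $\mathfrak A^2$ is the variety of metabelian (solvable of class $2$) Lie algebras, and $F_d(\mathfrak A^2)=L_d/L_d''$, where $L_d$ is the free Lie algebra freely generated by $X_d$ and $L_d''=[[L_d,L_d],[L_d,L_d]]$. $GL_d(K)$ acts canonically on the vector space $KX_d$ with basis $X_d$, and this action is extended to every $F_d(\mathfrak V)$ (including $F_d(\mathfrak A^2)$) by $g(f(x_1,\ldots,x_d))=f(g(x_1),\ldots,g(x_d))$.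 The superscript $G$ denotes the set of elements fixed by all $g\in G$. *)

(* Defs.v *)
From HB Require Import structures.
From mathcomp Require Import all_boot all_algebra finmap.
From mathcomp Require Import ring_quotient monalg boolp classical_sets.

Set Implicit Arguments.
Unset Strict Implicit.
Unset Printing Implicit Defensive.

Import GRing.Theory.
Local Open Scope classical_set_scope.
Local Open Scope quotient_scope.
Local Open Scope ring_scope.

HB.mixin Record Lmodule_isNAAlgebra (K : fieldType) A of GRing.Lmodule K A := {
  namul : A -> A -> A;
  namulDl : forall x y z, namul (x + y) z = namul x z + namul y z;
  namulDr : forall x y z, namul x (y + z) = namul x y + namul x z;
  namulZl : forall (c : K) x y, namul (c *: x) y = c *: namul x y;
  namulZr : forall (c : K) x y, namul x (c *: y) = c *: namul x y
}.

(* Algebras that need not be associative, commutative or unital. *)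
#[short(type="naalgType")]
HB.structure Definition NAAlgebra (K : fieldType) :=
  {A of Lmodule_isNAAlgebra K A & GRing.Lmodule K A}.

Notation "x ** y" := (namul x y) (at level 40, left associativity) : ring_scope.

Section NAAlgebraTheory.
Variables (K : fieldType) (A : naalgType K).
Implicit Types x y : A.

Lemma na0mul x : 0 ** x = 0.
Proof. by rewrite -(scale0r 0) namulZl !scale0r. Qed.

Lemma namul0 x : x ** 0 = 0.
Proof. by rewrite -(scale0r 0) namulZr !scale0r. Qed.

Lemma naNmul x y : (- x) ** y = - (x ** y).
Proof. by rewrite -scaleN1r namulZl scaleN1r. Qed.

Lemma namulN x y : x ** (- y) = - (x ** y).
Proof. by rewrite -scaleN1r namulZr scaleN1r. Qed.

Definition associator (x y z : A) : A := x ** (y ** z) - (x ** y) ** z.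

Definition is_subspace (B : set A) : Prop :=
  [/\ B 0, forall x y, B x -> B y -> B (x + y)
    & forall (c : K) x, B x -> B (c *: x)].

Definition is_subalgebra (B : set A) : Prop :=
  is_subspace B /\ forall x y, B x -> B y -> B (x ** y).

Definition infinite_dim (B : set A) : Prop :=
  ~ exists s : seq A, B = smallest is_subspace [set` s].

Definition finitely_generated (B : set A) : Prop :=
  exists s : seq A, B = smallest is_subalgebra [set` s].

End NAAlgebraTheory.

(* Nonassociative monomials: elements of the free magma on X. There is no
   empty monomial, so polynomials have no constant term. *)
Inductive magma (X : Type) : Type :=
| Leaf of X
| Node of magma X & magma X.

Section MagmaChoice.
Variable X : choiceType.

Fixpoint magma_encode (t : magma X) : GenTree.tree X :=
  match t with
  | Leaf x => GenTree.Leaf x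
  | Node s t => GenTree.Node 0 [:: magma_encode s; magma_encode t]
  end.

Fixpoint magma_decode (t : GenTree.tree X) : option (magma X) :=
  match t with
  | GenTree.Leaf x => Some (Leaf x)
  | GenTree.Node _ [:: s; t] =>
      if magma_decode s is Some s' then
        if magma_decode t is Some t' then Some (Node s' t') else None
      else None
  | _ => None
  end.

Lemma magma_encodeK : pcancel magma_encode magma_decode.
Proof. by elim=> //= s -> t ->. Qed.

HB.instance Definition _ := Choice.copy (magma X) (pcan_type magma_encodeK).
End MagmaChoice.

HB.lock Definition lext (K : fieldType) (T : choiceType) (V : lmodType K)
    (f : T -> V) (p : {malg K[T]}) : V :=
  \sum_(t <- msupp p) p@_t *: f t.

Section LinearExtension.
Variables (K : fieldType) (T : choiceType) (V : lmodType K).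
Implicit Types (f : T -> V) (p q : {malg K[T]}).

Lemma lextE f p : lext f p = \sum_(t <- msupp p) p@_t *: f t.
Proof. by rewrite lext.unlock. Qed.

Lemma lextw f p (D : {fset T}) : (msupp p `<=` D)%fset ->
  lext f p = \sum_(t <- D) p@_t *: f t.
Proof.
move=> sD; rewrite lextE; apply: big_fset_incl => // t _ tp.
by rewrite mcoeff_outdom // scale0r.
Qed.

Lemma lext_is_linear f : linear (lext f).
Proof.
move=> c p q.
pose D := (msupp p `|` msupp q `|` msupp (c *: p + q))%fset.
have sp : (msupp p `<=` D)%fset by rewrite /D -fsetUA fsubsetUl.
have sq : (msupp q `<=` D)%fset by rewrite /D fsetUAC fsubsetUr.
have sr : (msupp (c *: p + q) `<=` D)%fset by rewrite /D fsubsetUr.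
rewrite (lextw f sp) (lextw f sq) (lextw f sr) scaler_sumr -big_split /=.
by apply: eq_bigr => t _; rewrite mcoeffD mcoeffZ scalerDl scalerA.
Qed.

Lemma lextD f p q : lext f (p + q) = lext f p + lext f q.
Proof. by rewrite -[p]scale1r lext_is_linear !scale1r. Qed.

Lemma lext0 f : lext f 0 = 0.
Proof. by rewrite lextE msupp0 big_seq_fset0. Qed.

Lemma lextZ f c p : lext f (c *: p) = c *: lext f p.
Proof. by rewrite -[c *: p]addr0 lext_is_linear lext0 addr0. Qed.

Lemma lextN f p : lext f (- p) = - lext f p.
Proof. by rewrite -(scaleN1r p) lextZ scaleN1r. Qed.

Lemma lextU f t : lext f << t >> = f t.
Proof.
rewrite (@lextw _ _ [fset t]%fset) ?msuppU_le //.
by rewrite big_seq_fset1 mcoeffUU scale1r.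
Qed.

Lemma eq_lext f g p : f =1 g -> lext f p = lext g p.
Proof. by move=> fg; rewrite !lextE; apply: eq_bigr => t _; rewrite fg. Qed.

Lemma lextDf f g p : lext (fun t => f t + g t) p = lext f p + lext g p.
Proof.
by rewrite !lextE -big_split; apply: eq_bigr => t _; rewrite scalerDr.
Qed.

Lemma lextZf c f p : lext (fun t => c *: f t) p = c *: lext f p.
Proof.
rewrite !lextE scaler_sumr; apply: eq_bigr => t _.
by rewrite !scalerA mulrC.
Qed.

End LinearExtension.

Lemma lext_comp (K : fieldType) (T : choiceType) (V W : lmodType K)
    (h : {linear V -> W}) (f : T -> V) p :
  h (lext f p) = lext (fun t => h (f t)) p.
Proof.
by rewrite !lextE linear_sum; apply: eq_bigr => t _; rewrite linearZ.
Qed.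

Section FreeNAAlgebra.
Variables (K : fieldType) (X : choiceType).

(* The absolutely free algebra K{X}, without constant terms. *)
Definition freeNA : Type := {malg K[magma X]}.
HB.instance Definition _ := GRing.Lmodule.on freeNA.

Definition free_var (x : X) : freeNA := << Leaf x >>.

Definition free_mul (p q : freeNA) : freeNA :=
  lext (fun s => lext (fun t => << Node s t >> : freeNA) q) p.

Fact free_mulDl p q r : free_mul (p + q) r = free_mul p r + free_mul q r.
Proof. exact: lextD. Qed.

Fact free_mulDr p q r : free_mul p (q + r) = free_mul p q + free_mul p r.
Proof. by rewrite /free_mul -lextDf; apply: eq_lext => s; rewrite lextD. Qed.

Fact free_mulZl (c : K) p q : free_mul (c *: p) q = c *: free_mul p q.
Proof. exact: lextZ. Qed.

Fact free_mulZr (c : K) p q : free_mul p (c *: q) = c *: free_mul p q.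
Proof. by rewrite /free_mul -lextZf; apply: eq_lext => s; rewrite lextZ. Qed.

HB.instance Definition _ := Lmodule_isNAAlgebra.Build K freeNA
  free_mulDl free_mulDr free_mulZl free_mulZr.

End FreeNAAlgebra.

Section Evaluation.
Variables (K : fieldType) (X : choiceType).
Implicit Types (A : naalgType K) (p q : freeNA K X).

Fixpoint magma_eval A (a : X -> A) (t : magma X) : A :=
  match t with
  | Leaf x => a x
  | Node s t => magma_eval a s ** magma_eval a t
  end.

(* The value f(a_1, a_2, ...) of a polynomial f in an algebra A. *)
Definition na_eval A (a : X -> A) p : A := lext (magma_eval a) p.

Lemma na_eval_is_linear A (a : X -> A) : linear (na_eval a).
Proof. exact: lext_is_linear. Qed.

HB.instance Definition _ A (a : X -> A) :=
  GRing.isLinear.Build K (freeNA K X) A _ (na_eval a) (na_eval_is_linear a).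

Lemma na_eval_var A (a : X -> A) x : na_eval a (free_var K x) = a x.
Proof. exact: lextU. Qed.

Lemma na_evalM A (a : X -> A) p q :
  na_eval a (p ** q) = na_eval a p ** na_eval a q.
Proof.
rewrite [LHS]lext_comp.
transitivity (lext (fun s => magma_eval a s ** na_eval a q) p).
  apply: eq_lext => s; rewrite lext_comp [in RHS]/na_eval.
  rewrite !lextE; elim/big_rec2: _ => [|t x y _ ->]; first by rewrite namul0.
  rewrite namulDr namulZr; congr (_ *: _ + _); exact: lextU.
rewrite /na_eval !lextE; elim/big_rec2: _ => [|t x y _ ->].
  by rewrite na0mul.
by rewrite namulDl namulZl.
Qed.

Lemma na_eval_hom A (B : naalgType K) (h : {linear A -> B}) (a : X -> A) p :
  {morph h : x y / x ** y} -> h (na_eval a p) = na_eval (fun x => h (a x)) p.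
Proof.
move=> hM; rewrite /na_eval lext_comp; apply: eq_lext => t.
by elim: t => //= s <- t <-; rewrite hM.
Qed.

Lemma na_eval_eq A (a b : X -> A) p : a =1 b -> na_eval a p = na_eval b p.
Proof. by move=> /funext ->. Qed.

End Evaluation.

Section Varieties.
Variable K : fieldType.

Definition satisfies (A : naalgType K) (X : choiceType) (p : freeNA K X) :=
  forall a : X -> A, na_eval a p = 0.

(* Classes of algebras are plain predicates: set would raise a universe
   inconsistency on naalgType K. *)
Definition variety_of (S : set (freeNA K nat)) (A : naalgType K) : Prop :=
  forall p, S p -> satisfies A p.

Definition is_variety (V : naalgType K -> Prop) : Prop :=
  exists S, forall A, V A <-> variety_of S A.

Local Notation x_ i := (free_var K i%N).

Definition varL : naalgType K -> Prop :=
  variety_of [set associator (x_ 1) (x_ 2) (x_ 3)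
                    - associator (x_ 1) (x_ 3) (x_ 2);
                  x_ 1 ** (x_ 2 ** x_ 3)].

(* Metabelian Lie algebras; [A, A] is spanned by products, so solvability of
   class 2 is the single identity (x1 x2)(x3 x4) = 0, and F_d is L_d/L_d''. *)
Definition metabelianLie : naalgType K -> Prop :=
  variety_of ([set x_ 1 ** x_ 1;
                   (x_ 1 ** x_ 2) ** x_ 3 + (x_ 2 ** x_ 3) ** x_ 1
                     + (x_ 3 ** x_ 1) ** x_ 2]
              `|` [set (x_ 1 ** x_ 2) ** (x_ 3 ** x_ 4)]).

End Varieties.

Section RelativelyFree.
Variables (K : fieldType) (V : naalgType K -> Prop) (d : nat).
Local Notation F := (freeNA K 'I_d).

(* The polynomial identities of V in x_1, ..., x_d. *)
Definition identities : {pred F} :=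
  fun p => `[< forall A, V A -> satisfies A p >].

Lemma identitiesP p :
  reflect (forall A, V A -> satisfies A p) (p \in identities).
Proof. exact: asboolP. Qed.

Fact identities_zmod_closed : zmod_closed identities.
Proof.
split=> [|p q /identitiesP Ip /identitiesP Iq]; apply/identitiesP => A VA a.
  exact: linear0.
by rewrite linearB /= (Ip A VA) (Iq A VA) subr0.
Qed.

HB.instance Definition _ :=
  GRing.isZmodClosed.Build F identities identities_zmod_closed.

(* F_d(V). *)
Definition relfree : Type := Quotient.quot identities.
HB.instance Definition _ := GRing.Zmodule.on relfree.
HB.instance Definition _ := Quotient.on relfree.
Implicit Types u v w : relfree.

Definition relfree_pi (p : F) : relfree := \pi_relfree p.

Lemma relfree_reprK u : relfree_pi (repr u) = u.
Proof. exact: reprK. Qed.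

Lemma relfree_piP p q :
  (relfree_pi p = relfree_pi q) <-> (p - q \in identities).
Proof.
by rewrite Quotient.idealrBE; split=> [/eqP|/eqP].
Qed.

Lemma relfree_piD p q : relfree_pi (p + q) = relfree_pi p + relfree_pi q.
Proof. exact: Quotient.pi_add. Qed.

Lemma identitiesZ c p : p \in identities -> c *: p \in identities.
Proof.
by move=> /identitiesP Ip; apply/identitiesP => A VA a;
  rewrite linearZ /= (Ip A VA) scaler0.
Qed.

Lemma identitiesMl p q : q \in identities -> p ** q \in identities.
Proof.
by move=> /identitiesP Iq; apply/identitiesP => A VA a;
  rewrite na_evalM (Iq A VA) namul0.
Qed.

Lemma identitiesMr p q : p \in identities -> p ** q \in identities.
Proof.
by move=> /identitiesP Ip; apply/identitiesP => A VA a;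
  rewrite na_evalM (Ip A VA) na0mul.
Qed.

End RelativelyFree.

HB.lock Definition relfree_scale (K : fieldType) (V : naalgType K -> Prop)
    (d : nat) (c : K) (u : relfree V d) : relfree V d :=
  relfree_pi V (c *: repr u).

HB.lock Definition relfree_mul (K : fieldType) (V : naalgType K -> Prop)
    (d : nat) (u v : relfree V d) : relfree V d :=
  relfree_pi V (repr u ** repr v).

Section RelativelyFreeAlgebra.
Variables (K : fieldType) (V : naalgType K -> Prop) (d : nat).
Local Notation F := (freeNA K 'I_d).
Local Notation relfree := (relfree V d).
Local Notation relfree_pi := (@relfree_pi K V d).
Local Notation identities := (@identities K V d).
Local Notation relfree_scale := (@relfree_scale K V d).
Local Notation relfree_mul := (@relfree_mul K V d).
Implicit Types (p q : F) (u v w : relfree).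

Lemma relfree_piZ c p : relfree_pi (c *: p) = relfree_scale c (relfree_pi p).
Proof.
rewrite relfree_scale.unlock; apply/relfree_piP; rewrite -scalerBr; apply: identitiesZ.
by apply/relfree_piP; rewrite relfree_reprK.
Qed.

Lemma relfree_piM p q :
  relfree_pi (p ** q) = relfree_mul (relfree_pi p) (relfree_pi q).
Proof.
rewrite relfree_mul.unlock; apply/relfree_piP.
set p' := repr (relfree_pi p).
set q' := repr (relfree_pi q).
have -> : p ** q - p' ** q' = (p - p') ** q + p' ** (q - q').
  by rewrite namulDl namulDr naNmul namulN addrA subrK.
apply: rpredD; [apply: identitiesMr | apply: identitiesMl];
  by apply/relfree_piP; rewrite relfree_reprK.
Qed.

Fact relfree_scaleA c e u :
  relfree_scale c (relfree_scale e u) = relfree_scale (c * e) u.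
Proof. by rewrite -[u]relfree_reprK -!relfree_piZ scalerA. Qed.

Fact relfree_scale1 : left_id 1 relfree_scale.
Proof. by move=> u; rewrite -[u]relfree_reprK -!relfree_piZ scale1r. Qed.

Fact relfree_scaleDr : right_distributive relfree_scale +%R.
Proof.
move=> c u v; rewrite -[u]relfree_reprK -[v]relfree_reprK.
by rewrite -!(relfree_piD, relfree_piZ) scalerDr.
Qed.

Fact relfree_scaleDl u :
  {morph (fun c => relfree_scale c u) : c e / c + e}.
Proof.
move=> c e; rewrite -[u]relfree_reprK.
by rewrite -!(relfree_piD, relfree_piZ) scalerDl.
Qed.

HB.instance Definition _ := GRing.Zmodule_isLmodule.Build K relfree
  relfree_scaleA relfree_scale1 relfree_scaleDr relfree_scaleDl.

Fact relfree_mulDl u v w :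
  relfree_mul (u + v) w = relfree_mul u w + relfree_mul v w.
Proof.
rewrite -[u]relfree_reprK -[v]relfree_reprK -[w]relfree_reprK.
by rewrite -!(relfree_piD, relfree_piM) namulDl.
Qed.

Fact relfree_mulDr u v w :
  relfree_mul u (v + w) = relfree_mul u v + relfree_mul u w.
Proof.
rewrite -[u]relfree_reprK -[v]relfree_reprK -[w]relfree_reprK.
by rewrite -!(relfree_piD, relfree_piM) namulDr.
Qed.

Fact relfree_mulZl (c : K) u v : relfree_mul (c *: u) v = c *: relfree_mul u v.
Proof.
have := relfree_piZ c (repr u ** repr v).
rewrite -namulZl (relfree_piM (c *: repr u) (repr v)).
rewrite (relfree_piM (repr u) (repr v)) (relfree_piZ c (repr u)).
by rewrite (relfree_reprK u) (relfree_reprK v).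
Qed.

Fact relfree_mulZr (c : K) u v : relfree_mul u (c *: v) = c *: relfree_mul u v.
Proof.
have := relfree_piZ c (repr u ** repr v).
rewrite -namulZr (relfree_piM (repr u) (c *: repr v)).
rewrite (relfree_piM (repr u) (repr v)) (relfree_piZ c (repr v)).
by rewrite (relfree_reprK u) (relfree_reprK v).
Qed.

HB.instance Definition _ := Lmodule_isNAAlgebra.Build K relfree
  relfree_mulDl relfree_mulDr relfree_mulZl relfree_mulZr.

Fact relfree_pi_is_linear : linear relfree_pi.
Proof. by move=> c p q; rewrite relfree_piD relfree_piZ. Qed.

HB.instance Definition _ :=
  GRing.isLinear.Build K F relfree _ relfree_pi relfree_pi_is_linear.

Definition relfree_gen (i : 'I_d) : relfree := relfree_pi (free_var K i).

Lemma identities_subst p (a : 'I_d -> F) :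
  p \in identities -> na_eval a p \in identities.
Proof.
move=> /identitiesP Ip; apply/identitiesP => A VA b.
by rewrite (na_eval_hom a p (na_evalM b)) (Ip A VA).
Qed.

(* Substitution in an element of F_d(V): f(x_1, ..., x_d) is sent to
   f(u_1, ..., u_d), computed in F_d(V) on any representative of f. *)
Definition relfree_subst (a : 'I_d -> relfree) (u : relfree) : relfree :=
  na_eval a (repr u).

Lemma relfree_substE (a : 'I_d -> relfree) p :
  relfree_subst a (relfree_pi p) = na_eval a p.
Proof.
pose b i := repr (a i).
have abE q : na_eval a q = relfree_pi (na_eval b q).
  rewrite (na_eval_hom b q relfree_piM); apply: na_eval_eq => i.
  exact: esym (relfree_reprK (a i)).
rewrite /relfree_subst !abE; apply/relfree_piP; rewrite -linearB.
by apply: identities_subst; apply/relfree_piP; rewrite relfree_reprK.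
Qed.

(* g sends x_j to \sum_i g_ij x_i, so that in the basis x_1, ..., x_d it acts
   on K X_d by left multiplication on column vectors. *)
Definition GL_act (g : 'M[K]_d) : relfree -> relfree :=
  relfree_subst (fun j => \sum_i g i j *: relfree_gen i).

Lemma GL_act_linear_part g (v : 'cV[K]_d) :
  GL_act g (\sum_j v j 0 *: relfree_gen j) =
  \sum_i (g *m v) i 0 *: relfree_gen i.
Proof.
have -> : \sum_j v j 0 *: relfree_gen j =
          relfree_pi (\sum_j v j 0 *: free_var K j).
  by rewrite linear_sum; apply: eq_bigr => j _; rewrite linearZ.
rewrite /GL_act relfree_substE linear_sum /=.
transitivity (\sum_j \sum_i (g i j * v j 0) *: relfree_gen i).
  apply: eq_bigr => j _; rewrite linearZ /= na_eval_var scaler_sumr.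
  by apply: eq_bigr => i _; rewrite scalerA mulrC.
rewrite exchange_big /=; apply: eq_bigr => i _.
by rewrite [in RHS]mxE scaler_suml.
Qed.

Definition invariants (G : set 'M[K]_d) : set relfree :=
  [set u | forall g, G g -> GL_act g u = u].

End RelativelyFreeAlgebra.
Arguments invariants {K} V {d} G.

Definition GL_subgroup (K : fieldType) (d : nat) (G : set 'M[K]_d) : Prop :=
  [/\ forall g, G g -> g \in unitmx, G 1%:M,
      forall g h, G g -> G h -> G (g *m h)
    & forall g, G g -> G (invmx g)].

(* (K X_d)^G, in the coordinates of the basis X_d. *)
Definition linear_invariants (K : fieldType) (d : nat) (G : set 'M[K]_d) :
    set 'cV[K]_d :=
  [set v | forall g, G g -> g *m v = v].

(* Main.v *)
From HB Require Import structures.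
Require Import Defs.
From mathcomp Require Import all_boot all_algebra boolp classical_sets.
From mathcomp Require Import mpoly ring.
From mathcomp Require monalg finmap.

(** Why the theorem is true.

    Let W = K X_d. The relatively free algebra of the variety defined by
    (x1, x2, x3) = (x1, x3, x2) and x1 (x2 x3) = 0 is W (x) S(W): a product is
    determined by its first letter and the multiset of the others, and
    u v = lambda(v) u, where lambda(v) in W is the linear part of v. This
    algebra, [model], lies in every variety V of the theorem, so F_d(V) maps to
    it, equivariantly under GL_d.

    - If v is an invariant of F_d(V), its linear part is an invariant of W,
      hence zero, and so u v vanishes in the model. The image of F_d(V)^G in the
      model therefore has zero multiplication: if F_d(V)^G is generated by a
      finite set, the image is spanned by a finite set.

    - In characteristic 0 every invariant of the model lifts to F_d(V)^G. A
      tensor x_i (x) f is sent to x_i multiplied on the right by the letters of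
      f, averaged over all their orders ([symm]). This section is natural, hence
      equivariant for every matrix, so invariants lift for an arbitrary G. It is
      defined without any choice of order through Euler's formula
      (m+1) f = sum_k (d_k f) x_k for f of degree m+1 ([rsym]); equivariance is
      then the chain rule ([rsym_morph]).

    - The commutator algebra of the model is a metabelian Lie algebra, which
      gives an equivariant map phi : F_d(A^2) -> model. In degree n >= 2 its image
      lies in the kernel of the Koszul differential
      W (x) S^(n-1)(W) -> S^n(W), and the same symmetrization, now taken in the
      Lie algebra F_d(A^2), is a scalar multiple of a left inverse of phi: with
      m = n - 1 it recovers (m+1)/m times the original element
      ([symm_mulX_koszul], [koszul_inv_phi]). The left inverse is again
      equivariant.

    Hence F_d(A^2)^G is the image under the left inverse of the image of
    F_d(V)^G in the model, and it is finite-dimensional as soon as F_d(V)^G is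
    finitely generated. *)

Set Implicit Arguments.
Unset Strict Implicit.
Unset Printing Implicit Defensive.

Import GRing.Theory.
Local Open Scope classical_set_scope.
Local Open Scope ring_scope.

(** * Bilinearity over finite sums *)

Section Products.
Variables (K : fieldType) (A : naalgType K).

Lemma namul_suml I (r : seq I) (P : pred I) (F : I -> A) y :
  (\sum_(i <- r | P i) F i) ** y = \sum_(i <- r | P i) F i ** y.
Proof. exact: (big_morph (fun x => x ** y) (fun a b => namulDl a b y) (na0mul y)). Qed.

Lemma namul_sumr I (r : seq I) (P : pred I) (F : I -> A) x :
  x ** (\sum_(i <- r | P i) F i) = \sum_(i <- r | P i) x ** F i.
Proof. exact: (big_morph (fun y => x ** y) (namulDr x) (namul0 x)). Qed.

End Products.

(** * Linear substitutions and partial derivatives *)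

Section Polynomials.
Variables (K : fieldType) (d : nat).
Implicit Types (f p q : {mpoly K[d]}) (g : 'M[K]_d).

Lemma mpoly_algebra_ind (P : {mpoly K[d]} -> Prop) :
  (forall c, P c%:MP) -> (forall i, P 'X_i) ->
  (forall p q, P p -> P q -> P (p + q)) ->
  (forall p q, P p -> P q -> P (p * q)) -> forall p, P p.
Proof.
move=> PC PX PD PM; elim/mpolyind; first by rewrite -mpolyC0.
move=> c m p _ _ Pp; apply: PD => //; rewrite -mul_mpolyC; apply: (PM) => //.
rewrite mpolyXE_id; apply: (big_ind P); [by rewrite -mpolyC1 | exact: PM | move=> i _].
by elim: (m i) => [|n Pn]; rewrite ?expr0 -?mpolyC1 // exprS; apply: (PM).
Qed.

Lemma mderivXU k i : ('X_i : {mpoly K[d]})^`M(k) = (k == i)%:R.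
Proof.
rewrite mderivX mnm1E eq_sym; case: eqP => [->|_]; last by rewrite scale0r.
by rewrite -{1}[U_(i)%MM]add0m addmK mpolyX0 scale1r.
Qed.

Lemma mcoeff0_X i : ('X_i : {mpoly K[d]})@_0%MM = 0.
Proof. by rewrite mcoeffX -mdeg_eq0 mdeg1. Qed.

(** The action of a matrix on S(W): a polynomial is composed with the linear forms
    [g] 'X_j = sum_i g_ij 'X_i, the convention used for [GL_act]. *)
Definition msubst g f : {mpoly K[d]} :=
  f \mPo [tuple \sum_i g i j *: 'X_i | j < d].

HB.instance Definition _ g := GRing.RMorphism.copy (msubst g)
  (comp_mpoly [tuple \sum_i g i j *: 'X_i | j < d]).
HB.instance Definition _ g := GRing.Linear.copy (msubst g)
  (comp_mpoly [tuple \sum_i g i j *: 'X_i | j < d]).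

Lemma msubstX g j : msubst g 'X_j = \sum_i g i j *: 'X_i.
Proof. by rewrite /msubst comp_mpolyXU -tnth_nth tnth_mktuple. Qed.

Lemma mcoeff0_msubst g f : (msubst g f)@_0%MM = f@_0%MM.
Proof.
elim/mpoly_algebra_ind: f => [c|j|p q IHp IHq|p q IHp IHq].
- by rewrite /msubst comp_mpolyC.
- rewrite msubstX raddf_sum /= big1 => [|i _].
    by rewrite mcoeff0_X.
  by rewrite mcoeffZ mcoeff0_X mulr0.
- by rewrite rmorphD /= !mcoeffD IHp IHq.
- by rewrite rmorphM /= !rmorphM /= IHp IHq.
Qed.

Lemma mderiv_msubst g f k :
  (msubst g f)^`M(k) = \sum_j g k j *: msubst g f^`M(j).
Proof.
elim/mpoly_algebra_ind: f => [c|j|p q IHp IHq|p q IHp IHq].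
- rewrite /msubst comp_mpolyC mderivC big1 // => j _.
  by rewrite mderivC linear0 scaler0.
- rewrite msubstX linear_sum /= [LHS](bigD1 k) //= [RHS](bigD1 j) //=.
  rewrite linearZ /= !mderivXU !eqxx (rmorph1 (msubst g)) !big1 ?addr0 // => [l lj|i ik].
    by rewrite mderivXU (negPf lj) raddf0 scaler0.
  by rewrite linearZ /= mderivXU eq_sym (negPf ik) scaler0.
- rewrite rmorphD /= mderivD IHp IHq -big_split; apply: eq_bigr => j _ /=.
  by rewrite mderivD rmorphD scalerDr.
- rewrite rmorphM /= mderivM IHp IHq mulr_suml mulr_sumr -big_split /=.
  apply: eq_bigr => j _; rewrite mderivM rmorphD !rmorphM /= scalerDr.
  by rewrite scalerAl scalerAr.
Qed.

Lemma msubst1 f : msubst 1%:M f = f.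
Proof.
rewrite -[RHS]comp_mpoly_id; congr comp_mpoly; apply: eq_from_tnth => j.
rewrite !tnth_mktuple (bigD1 j) //= mxE eqxx scale1r big1 ?addr0 // => i ij.
by rewrite mxE (negPf ij) scale0r.
Qed.

End Polynomials.

(** * Symmetrized right multiplication *)

Section SymmetrizedMultiplication.
Variables (K : fieldType) (d : nat) (A : naalgType K) (x : 'I_d -> A).
Implicit Types (f : {mpoly K[d]}) (v : A).

(** The component of [f] of degree [m], acting on [v] by right multiplications by
    the [x k], averaged over all orders of the factors. Euler's formula replaces
    the sum over orders: [m.+1] derivations followed by the constant term see only
    the component of degree [m.+1], and the last factor [x k] is split off. Stated
    in this form, the map commutes with linear substitutions by the chain rule. *)
Fixpoint rsym m v f : A :=
  if m is m'.+1 then m'.+1%:R^-1 *: \sum_k rsym m' v f^`M(k) ** x k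
  else f@_0%MM *: v.

Fact rsym_is_linear m v : linear (rsym m v).
Proof.
elim: m => [|m IHm] c f h /=; first by rewrite mcoeffD mcoeffZ scalerDl scalerA.
under eq_bigr do rewrite linearP IHm namulDl namulZl.
by rewrite big_split -scaler_sumr scalerDr !scalerA [c * _]mulrC.
Qed.

HB.instance Definition _ m v :=
  GRing.isLinear.Build K {mpoly K[d]} A _ (rsym m v) (rsym_is_linear m v).

Lemma rsymP m c v w f : rsym m (c *: v + w) f = c *: rsym m v f + rsym m w f.
Proof.
elim: m f => [|m IHm] f /=; first by rewrite scalerDr !scalerA mulrC.
under eq_bigr do rewrite IHm namulDl namulZl.
by rewrite big_split -scaler_sumr scalerDr !scalerA [c * _]mulrC.
Qed.

Lemma rsymDv m v w f : rsym m (v + w) f = rsym m v f + rsym m w f.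
Proof. by rewrite -[v]scale1r rsymP !scale1r. Qed.

Lemma rsym0v m f : rsym m 0 f = 0.
Proof. by apply: (addrI (rsym m 0 f)); rewrite -rsymDv !addr0. Qed.

Lemma rsymZv m c v f : rsym m (c *: v) f = c *: rsym m v f.
Proof. by rewrite -[c *: v]addr0 rsymP rsym0v addr0. Qed.

Lemma rsymNv m v f : rsym m (- v) f = - rsym m v f.
Proof. by rewrite -scaleN1r rsymZv scaleN1r. Qed.

Lemma rsym_sumv m I (r : seq I) (F : I -> A) f :
  rsym m (\sum_(i <- r) F i) f = \sum_(i <- r) rsym m (F i) f.
Proof. exact: (big_morph (rsym m ^~ f) (fun a b => rsymDv m a b f) (rsym0v m f)). Qed.

Lemma rsym0 v f : rsym 0 v f = f@_0%MM *: v.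
Proof. by []. Qed.

Lemma rsym_rec m v f :
  rsym m.+1 v f = m.+1%:R^-1 *: \sum_k rsym m v f^`M(k) ** x k.
Proof. by []. Qed.

Lemma rsym_high m v f : (msize f <= m)%N -> rsym m v f = 0.
Proof.
move=> fm; have {fm}: forall mu, (m <= mdeg mu)%N -> f@_mu = 0.
  move=> mu le_m_mu; apply/eqP; rewrite mcoeff_eq0.
  exact/msize_mdeg_ge/(leq_trans fm).
elim: m f => [|m IHm] f f0 /=; first by rewrite f0 // scale0r.
rewrite big1 ?scaler0 // => k _; rewrite IHm ?na0mul // => mu le_m_mu.
by rewrite mcoeff_deriv f0 ?mul0rn // mdegD mdeg1 addn1.
Qed.

End SymmetrizedMultiplication.

Arguments rsym : simpl never.

(** * The module W (x) S(W) and its symmetrization map *)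

Section Symmetrization.
Variables (K : fieldType) (d : nat).

(** W (x) S(W), with the [i]-th coordinate of [w] the coefficient of x_i (x) _. *)
Definition model : Type := {ffun 'I_d -> {mpoly K[d]}}.
HB.instance Definition _ := GRing.Lmodule.on model.

Definition symm (A : naalgType K) (x : 'I_d -> A) m (w : model) : A :=
  \sum_i rsym x m (x i) (w i).

Fact symm_is_linear (A : naalgType K) (x : 'I_d -> A) m : linear (symm x m).
Proof.
move=> c u w; rewrite /symm scaler_sumr -big_split; apply: eq_bigr => i _ /=.
by rewrite !ffunE linearP.
Qed.

HB.instance Definition _ (A : naalgType K) (x : 'I_d -> A) m :=
  GRing.isLinear.Build K model A _ (symm x m) (symm_is_linear x m).

Definition gl_model (g : 'M[K]_d) (w : model) : model :=
  [ffun i => \sum_j g i j *: msubst g (w j)].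

Fact gl_model_is_linear g : linear (gl_model g).
Proof.
move=> c u w; apply/ffunP => i; rewrite !ffunE scaler_sumr -big_split.
by apply: eq_bigr => j _ /=; rewrite !ffunE linearP scalerDr !scalerA mulrC.
Qed.

HB.instance Definition _ g :=
  GRing.isLinear.Build K model model _ (gl_model g) (gl_model_is_linear g).

Lemma gl_model1 w : gl_model 1%:M w = w.
Proof.
apply/ffunP => i; rewrite ffunE (bigD1 i) //= mxE eqxx scale1r msubst1.
by rewrite big1 ?addr0 // => j ji; rewrite mxE eq_sym (negPf ji) scale0r.
Qed.

(** Equivariance of symmetrization. The sum over [k] in the recursion contracts
    derivatives with generators, and the chain rule moves the matrix from one to
    the other. *)
Lemma rsym_morph (A B : naalgType K) (h : {linear A -> B})
    (x : 'I_d -> A) (y : 'I_d -> B) (g : 'M[K]_d) m v f :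
  {morph h : a b / a ** b} -> (forall j, h (x j) = \sum_i g i j *: y i) ->
  h (rsym x m v f) = rsym y m (h v) (msubst g f).
Proof.
move=> hM hx; elim: m f => [|m IHm] f.
  by rewrite !rsym0 linearZ mcoeff0_msubst.
rewrite !rsym_rec linearZ linear_sum; congr (_ *: _) => /=.
under eq_bigr do rewrite hM IHm hx namul_sumr.
rewrite exchange_big; apply: eq_bigr => k _ /=.
rewrite mderiv_msubst linear_sum namul_suml; apply: eq_bigr => j _ /=.
by rewrite namulZr linearZ namulZl.
Qed.

Lemma symm_morph (A B : naalgType K) (h : {linear A -> B})
    (x : 'I_d -> A) (y : 'I_d -> B) (g : 'M[K]_d) m w :
  {morph h : a b / a ** b} -> (forall j, h (x j) = \sum_i g i j *: y i) ->
  h (symm x m w) = symm y m (gl_model g w).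
Proof.
move=> hM hx; rewrite /symm linear_sum /=.
under eq_bigr do rewrite (rsym_morph _ _ _ hM hx) hx rsym_sumv.
rewrite exchange_big; apply: eq_bigr => i _ /=.
rewrite ffunE linear_sum; apply: eq_bigr => j _ /=.
by rewrite rsymZv linearZ.
Qed.

Lemma symm_high (A : naalgType K) (x : 'I_d -> A) m (w : model) :
  (forall i, msize (w i) <= m)%N -> symm x m w = 0.
Proof. by move=> wm; apply: big1 => i _; rewrite rsym_high. Qed.

Definition model_gen j : model := [ffun i => (i == j)%:R].

Lemma msize_model_gen j i : (msize (model_gen j i) <= 1)%N.
Proof. by rewrite ffunE; case: eqP => _; rewrite ?msize1 ?msize0. Qed.

Lemma symm_gen (A : naalgType K) (x : 'I_d -> A) m j :
  symm x m (model_gen j) = if m is 0 then x j else 0.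
Proof.
case: m => [|m]; last first.
  by apply: symm_high => i; apply: leq_trans (msize_model_gen j i) _.
rewrite /symm (bigD1 j) //= rsym0 ffunE eqxx mcoeff1 eqxx scale1r.
by rewrite big1 ?addr0 // => i ij; rewrite ffunE (negPf ij) linear0.
Qed.

End Symmetrization.
Arguments model_gen {K d} j.

(** * The defining identities as equations *)

Lemma na_evalD (K : fieldType) (X : choiceType) (A : naalgType K) (a : X -> A)
    (p q : freeNA K X) : na_eval a (p + q) = na_eval a p + na_eval a q.
Proof. exact: linearD. Qed.

Lemma na_evalB (K : fieldType) (X : choiceType) (A : naalgType K) (a : X -> A)
    (p q : freeNA K X) : na_eval a (p - q) = na_eval a p - na_eval a q.
Proof. exact: linearB. Qed.

Lemma na_evalM3 (K : fieldType) (X : choiceType) (A : naalgType K) (a : X -> A)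
    (p q r : freeNA K X) :
  na_eval a (p ** q ** r) = na_eval a p ** na_eval a q ** na_eval a r.
Proof. by rewrite na_evalM; congr (_ ** _); rewrite na_evalM. Qed.

Lemma na_eval_associator (K : fieldType) (X : choiceType) (A : naalgType K)
    (a : X -> A) (p q r : freeNA K X) :
  na_eval a (associator p q r) =
  associator (na_eval a p) (na_eval a q) (na_eval a r).
Proof.
rewrite na_evalB na_evalM3; congr (_ - _); rewrite na_evalM.
by congr (_ ** _); rewrite na_evalM.
Qed.

Section VarietyAxioms.
Variables (K : fieldType) (A : naalgType K).
Local Notation x_ i := (free_var K i%N).

Lemma metabelianLieP :
  metabelianLie A <->
  [/\ forall x : A, x ** x = 0,
      forall x y z : A, (x ** y) ** z + (y ** z) ** x + (z ** x) ** y = 0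
    & forall x y z t : A, (x ** y) ** (z ** t) = 0].
Proof.
have Esq (a : nat -> A) : na_eval a (x_ 1 ** x_ 1) = a 1%N ** a 1%N.
  by rewrite na_evalM !na_eval_var.
have Ejac (a : nat -> A) : na_eval a (x_ 1 ** x_ 2 ** x_ 3 + x_ 2 ** x_ 3 ** x_ 1
      + x_ 3 ** x_ 1 ** x_ 2) =
    a 1%N ** a 2 ** a 3 + a 2 ** a 3 ** a 1%N + a 3 ** a 1%N ** a 2.
  rewrite !na_evalD; congr (_ + _ + _); rewrite na_evalM3; congr (_ ** _ ** _);
    exact: na_eval_var.
have Emet (a : nat -> A) : na_eval a ((x_ 1 ** x_ 2) ** (x_ 3 ** x_ 4)) =
    (a 1%N ** a 2) ** (a 3 ** a 4).
  rewrite na_evalM; congr (_ ** _); rewrite na_evalM; congr (_ ** _);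
    exact: na_eval_var.
pose a (x y z t : A) n := nth 0 [:: 0; x; y; z; t] n.
split=> [LA | [L1 L2 L3] p].
- split=> [x|x y z|x y z t].
  + by have /(_ (a x 0 0 0)) := LA _ (or_introl (or_introl erefl)); rewrite Esq.
  + by have /(_ (a x y z 0)) := LA _ (or_introl (or_intror erefl)); rewrite Ejac.
  + by have /(_ (a x y z t)) := LA _ (or_intror erefl); rewrite Emet.
- by case=> [[->|->]|->] b; [rewrite Esq L1 | rewrite Ejac L2 | rewrite Emet L3].
Qed.

Lemma varLP :
  varL A <-> (forall x y z : A, x ** (y ** z) = 0) /\
             (forall x y z : A, (x ** y) ** z = (x ** z) ** y).
Proof.
have Eprod (a : nat -> A) : na_eval a (x_ 1 ** (x_ 2 ** x_ 3)) =
    a 1%N ** (a 2 ** a 3).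
  rewrite na_evalM; congr (_ ** _); first exact: na_eval_var.
  by rewrite na_evalM; congr (_ ** _); exact: na_eval_var.
have Eass (a : nat -> A) : na_eval a (associator (x_ 1) (x_ 2) (x_ 3)
      - associator (x_ 1) (x_ 3) (x_ 2)) =
    associator (a 1%N) (a 2) (a 3) - associator (a 1%N) (a 3) (a 2).
  rewrite na_evalB; congr (_ - _); rewrite na_eval_associator;
    congr associator; exact: na_eval_var.
pose a (x y z : A) n := nth 0 [:: 0; x; y; z] n.
split=> [LA | [L1 L2] p].
- have L1 x y z : x ** (y ** z) = 0 :> A.
    by have /(_ (a x y z)) := LA _ (or_intror erefl); rewrite Eprod.
  split=> // x y z; have /(_ (a x y z)) := LA _ (or_introl erefl).
  rewrite Eass /associator /= !L1 !sub0r opprK addrC => /eqP.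
  by rewrite subr_eq0 eq_sym => /eqP.
- case=> -> b; last by rewrite Eprod L1.
  by rewrite Eass /associator !L1 !sub0r opprK addrC L2 subrr.
Qed.

End VarietyAxioms.

(** * Commutator algebras *)

(** A type of its own, since [A] and its commutator algebra are two algebra structures
    on one vector space. *)
Definition commutator_algebra (K : fieldType) (A : naalgType K) : Type := A.

Section CommutatorAlgebra.
Variables (K : fieldType) (A : naalgType K).
Local Notation Am := (commutator_algebra A).

HB.instance Definition _ := GRing.Lmodule.on Am.

Definition commutator (x y : Am) : Am := (x : A) ** y - (y : A) ** x.

Fact commutatorDl x y z : commutator (x + y) z = commutator x z + commutator y z.
Proof. by rewrite /commutator namulDl namulDr opprD addrACA. Qed.

Fact commutatorDr x y z : commutator x (y + z) = commutator x y + commutator x z.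
Proof. by rewrite /commutator namulDl namulDr opprD addrACA. Qed.

Fact commutatorZl (c : K) x y : commutator (c *: x) y = c *: commutator x y.
Proof. by rewrite /commutator namulZl namulZr scalerBr. Qed.

Fact commutatorZr (c : K) x y : commutator x (c *: y) = c *: commutator x y.
Proof. by rewrite /commutator namulZl namulZr scalerBr. Qed.

HB.instance Definition _ := Lmodule_isNAAlgebra.Build K Am
  commutatorDl commutatorDr commutatorZl commutatorZr.

Lemma commutatorE (x y : Am) : x ** y = (x : A) ** y - (y : A) ** x.
Proof. by []. Qed.

(** By x (y z) = 0, the bracket [[x, y], z] is (x y) z - (y x) z, and right symmetry
    pairs off the six terms of the Jacobi sum. *)
Lemma commutator_metabelianLie : varL A -> metabelianLie Am.
Proof.
move=> /varLP[L1 L2]; apply/metabelianLieP; split=> [x|x y z|x y z t].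
- by rewrite commutatorE subrr.
- rewrite !commutatorE !(namulDl, namulDr, naNmul, namulN, L1).
  rewrite !(oppr0, addr0) (L2 y x z) (L2 z y x) (L2 x z y).
  by rewrite addrA addrA subrK subrK subrr.
- by rewrite !commutatorE !(namulDl, namulDr, naNmul, namulN, L1) !(oppr0, addr0).
Qed.

End CommutatorAlgebra.

(** * Symmetrization in a metabelian Lie algebra *)

Section LieSymmetrization.
Variables (K : fieldType) (charK : [pchar K] =i pred0).
Variables (d : nat) (A : naalgType K) (LA : metabelianLie A) (x : 'I_d -> A).
Local Notation model := (model K d).
Implicit Types (f : {mpoly K[d]}) (u v : A) (w : model).
Local Notation rsym := (rsym x).

Let natK0 n : n.+1%:R != 0 :> K.
Proof. by have /pcharf0P -> := charK. Qed.

Lemma lie_mulC u v : u ** v = - (v ** u).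
Proof.
have [sq _ _] := proj1 (metabelianLieP A) LA.
apply/eqP; rewrite -addr_eq0; apply/eqP.
by have := sq (u + v); rewrite namulDl !namulDr !sq addr0 add0r.
Qed.

Lemma lie_jacobi (a b c : A) : a ** b ** c = a ** c ** b + c ** b ** a.
Proof.
have [_ jac _] := proj1 (metabelianLieP A) LA.
apply/eqP; rewrite -subr_eq0 opprD addrA; apply/eqP.
rewrite -[RHS](jac a b c) (lie_mulC a c) (lie_mulC c b) !naNmul !opprK.
by rewrite addrAC.
Qed.

(** In a metabelian Lie algebra the operators ad commute on the derived algebra,
    so there the symmetrized multiplication is an honest action of S(W); on the
    generators themselves they do not commute. *)
Definition right_commuting v := forall a b : A, v ** a ** b = v ** b ** a.

Lemma right_commuting_mul (a b : A) : right_commuting (a ** b).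
Proof.
have [_ _ met] := proj1 (metabelianLieP A) LA.
by move=> y z; rewrite lie_jacobi (lie_mulC (z ** y)) met oppr0 addr0.
Qed.

Lemma right_commutingZ c v : right_commuting v -> right_commuting (c *: v).
Proof. by move=> Cv a b; rewrite !namulZl Cv. Qed.

Lemma right_commuting_sum I (r : seq I) (F : I -> A) :
  (forall i, right_commuting (F i)) -> right_commuting (\sum_(i <- r) F i).
Proof. by move=> CF a b; rewrite !namul_suml; apply: eq_bigr => i _; apply: CF. Qed.

Lemma right_commuting_rsym m v f : right_commuting v -> right_commuting (rsym m v f).
Proof.
case: m => [|m] Cv; apply: right_commutingZ => //.
by apply: right_commuting_sum => k; apply: right_commuting_mul.
Qed.

Lemma rsymS m v f :
  m.+1%:R *: rsym m.+1 v f = \sum_k rsym m v f^`M(k) ** x k.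
Proof. by rewrite rsym_rec scalerA mulfV // scale1r. Qed.

Lemma rsym0X v k f : rsym 0 v ('X_k * f) = 0.
Proof. by rewrite rsym0 rmorphM /= mcoeff0_X mul0r scale0r. Qed.

(** On [v] all right multiplications commute, so the average over the position of
    [x b] is an average of equal terms. *)
Lemma rsymX m v b f : right_commuting v ->
  rsym m.+1 v ('X_b * f) = rsym m v f ** x b.
Proof.
move=> Cv; elim: m f => [|m IHm] f;
  [apply: (scalerI (natK0 0)) | apply: (scalerI (natK0 m.+1))]; rewrite rsymS.
all: under eq_bigr do rewrite mderivM linearD namulDl /= mderivXU.
all: rewrite big_split /= (bigD1 b) //= eqxx mul1r.
all: rewrite [X in _ + X + _]big1 ?addr0 => [|k kb];
  last by rewrite (negPf kb) mul0r linear0 na0mul.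
  rewrite big1 ?addr0 ?scale1r // => k _.
  by rewrite rsym0X na0mul.
rewrite -[m.+2]add1n natrD scalerDl scale1r; congr (_ + _).
rewrite -namulZl rsymS namul_suml; apply: eq_bigr => k _.
by rewrite IHm; apply: right_commuting_rsym.
Qed.

Lemma rsymMv m v b f : right_commuting v ->
  rsym m (v ** x b) f = rsym m v f ** x b.
Proof.
move=> Cv; elim: m f => [|m IHm] f; first by rewrite !rsym0 namulZl.
rewrite !rsym_rec namulZl namul_suml; congr (_ *: _); apply: eq_bigr => k _.
by rewrite IHm; apply: right_commuting_rsym.
Qed.

(** The recursion of [rsym] splits off the last factor; this is the same formula
    with the first factor split off, valid for every [v] since averaging is
    indifferent to the position. *)
Lemma rsymSv m v f :
  m.+1%:R *: rsym m.+1 v f = \sum_k rsym m (v ** x k) f^`M(k).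
Proof.
elim: m f => [|m IHm] f; rewrite rsymS; first by under eq_bigr do rewrite rsym0 namulZl.
apply: (scalerI (natK0 m)); rewrite !scaler_sumr.
under eq_bigr do rewrite -namulZl IHm namul_suml.
rewrite exchange_big; apply: eq_bigr => l _ /=.
rewrite rsymS; apply: eq_bigr => k _; by rewrite mderiv_comm.
Qed.

(** The Koszul differential W (x) S(W) -> S(W). *)
Definition koszul w : {mpoly K[d]} := \sum_i 'X_i * w i.

Lemma koszul_deriv w k : koszul w = 0 -> \sum_i 'X_i * (w i)^`M(k) = - w k.
Proof.
move=> /(congr1 (mderiv k)); rewrite raddf_sum mderiv0 /=.
under eq_bigr do rewrite mderivM mderivXU.
rewrite big_split /= (bigD1 k) //= eqxx mul1r big1 ?addr0 => [/eqP|i ik].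
  by rewrite addrC addr_eq0 => /eqP.
by rewrite eq_sym (negPf ik) mul0r.
Qed.

Lemma koszul_const w k : koszul w = 0 -> (w k)@_0%MM = 0.
Proof.
move=> w0; have := congr1 (mcoeff 0%MM) (koszul_deriv k w0).
rewrite raddf_sum big1 /= => [/esym|i _].
  by rewrite raddfN /= => /eqP; rewrite oppr_eq0 => /eqP.
by rewrite rmorphM /= mcoeff0_X mul0r.
Qed.

(** For a Koszul cycle [w], bracketing the symmetrization with [x b] is, up to a
    scalar, the same as inserting [x b] right after the first letter. The Jacobi
    identity [x_i, x_k, x_b] = [x_i, x_b, x_k] + [x_b, x_k, x_i] yields the wanted
    term and an error; summed over [i], the error involves
    sum_i X_i d_k w_i = - w_k ([koszul_deriv]), so it is one more copy of the
    wanted term. *)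
Lemma symm_mul_koszul m w b : koszul w = 0 ->
  m.+1%:R *: symm x m.+1 w ** x b =
  m.+2%:R *: \sum_i rsym m.+1 (x i ** x b) (w i).
Proof.
move=> w0; have Cmul := right_commuting_mul.
rewrite /symm namulZl namul_suml scaler_sumr.
under eq_bigr => i _.
  rewrite -namulZl rsymSv namul_suml.
  under eq_bigr => k _.
    rewrite -rsymMv; last exact: Cmul.
    rewrite lie_jacobi rsymDv rsymMv; last exact: Cmul.
    rewrite [X in _ + X]rsymMv; last exact: Cmul.
    rewrite -[X in _ + X]rsymX; last exact: Cmul.
    over.
  rewrite big_split -rsymS /=.
  over.
rewrite big_split -scaler_sumr /= exchange_big /=.
under [X in _ + X]eq_bigr => k _.
  rewrite -linear_sum /= koszul_deriv // linearN -rsymNv -lie_mulC /=.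
  over.
by rewrite -[m.+2]addn1 natrD scalerDl scale1r.
Qed.

(** In degree [m] the symmetrization of the image of a Lie element is (m+1)/m times
    that element, except for generators, which are recovered exactly. *)
Definition koszul_weight m : K := if m is 0 then 1 else m%:R / m.+1%:R.

Definition mulX b w : model := [ffun i => 'X_b * w i].

Lemma symm0_mulX w b : symm x 0 (mulX b w) = 0.
Proof. by rewrite /symm big1 // => i _; rewrite ffunE rsym0X. Qed.

(** Among the positions of the new factor [x b], averaged over all orders, the
    first one after the leading letter gives the first summand, and the other [m],
    where right multiplications already commute, give the second. *)
Lemma symm_mulX m w b :
  m.+1%:R *: symm x m.+1 (mulX b w) =
  \sum_i rsym m (x i ** x b) (w i) + m%:R *: symm x m w ** x b.
Proof.
rewrite /symm namulZl namul_suml !scaler_sumr -big_split; apply: eq_bigr => i _ /=.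
rewrite ffunE rsymSv.
under eq_bigr do rewrite mderivM linearD mderivXU /=.
rewrite big_split /= (bigD1 b) //= eqxx mul1r big1 ?addr0 => [|k kb]; last first.
  by rewrite (negPf kb) mul0r linear0.
congr (_ + _); case: m => [|m].
  by rewrite scale0r big1 // => k _; rewrite rsym0X.
rewrite -namulZl rsymSv namul_suml; apply: eq_bigr => k _.
by rewrite rsymX //; apply: right_commuting_mul.
Qed.

(** On Koszul cycles, multiplication by X_b in the model corresponds to bracketing
    with [x b] after the rescaling by [koszul_weight]: this is the inductive step
    that turns symmetrization into a left inverse of evaluation. *)
Lemma symm_mulX_koszul m w b : koszul w = 0 ->
  koszul_weight m.+1 *: symm x m.+1 (mulX b w) =
  koszul_weight m *: symm x m w ** x b.
Proof.
move=> w0; case: m => [|m].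
  have s0: symm x 0 w = 0.
    by rewrite /symm big1 // => i _; rewrite rsym0 koszul_const // scale0r.
  have := symm_mulX 0 w b; rewrite s0 scaler0 na0mul addr0 scale1r => ->; rewrite scaler0 na0mul.
  by rewrite big1 ?scaler0 // => i _; rewrite rsym0 koszul_const // scale0r.
have nz := (natK0 m.+1, natK0 m.+2).
have := symm_mulX m.+1 w b; have := symm_mul_koszul m b w0.
rewrite !namulZl.
set D := \sum_i _; set S := _ ** _; set T := symm _ _ _ => SD TD.
have {SD} DE: D = (m.+1%:R / m.+2%:R) *: S.
  by rewrite mulrC -scalerA SD scalerA mulVf ?scale1r ?nz.
have {TD} TE: T = m.+2%:R^-1 *: (D + m.+1%:R *: S).
  by rewrite -TD scalerA mulVf ?scale1r ?nz.
rewrite TE DE -scalerDl !scalerA; congr (_ *: _).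
by rewrite /koszul_weight; field; rewrite -!natrD !natK0.
Qed.

(** The left inverse of evaluation in the model is a sum over all degrees; it is
    truncated here, and [koszul_inv_high] says that a truncation beyond the degree
    of [w] changes nothing. *)
Definition koszul_inv N w : A := \sum_(m < N) koszul_weight m *: symm x m w.

Fact koszul_inv_is_linear N : linear (koszul_inv N).
Proof.
move=> c u w; rewrite /koszul_inv scaler_sumr -big_split; apply: eq_bigr => m _ /=.
by rewrite linearP scalerDr !scalerA mulrC.
Qed.

HB.instance Definition _ N :=
  GRing.isLinear.Build K model A _ (koszul_inv N) (koszul_inv_is_linear N).

Lemma koszul_inv_high M N w : (forall i, msize (w i) <= M)%N -> (M <= N)%N ->
  koszul_inv N w = koszul_inv M w.
Proof.
move=> wM MN; rewrite /koszul_inv -(subnKC MN) big_split_ord /=.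
rewrite [X in _ + X]big1 ?addr0 // => m _; rewrite symm_high ?scaler0 // => i.
exact: leq_trans (wM i) (leq_addr _ _).
Qed.

Lemma koszul_inv_mulX N w b : koszul w = 0 ->
  koszul_inv N.+1 (mulX b w) = koszul_inv N w ** x b.
Proof.
move=> w0; rewrite /koszul_inv big_ord_recl symm0_mulX scaler0 add0r namul_suml.
by apply: eq_bigr => m _; rewrite symm_mulX_koszul.
Qed.

Lemma symm_mulX_gen m a b :
  symm x m.+1 (mulX b (model_gen a)) = if m is 0 then x a ** x b else 0.
Proof.
apply: (scalerI (natK0 m)); rewrite symm_mulX symm_gen; case: m => [|m].
  rewrite scale0r na0mul addr0 scale1r (bigD1 a) //= rsym0 ffunE eqxx.
  rewrite mcoeff1 eqxx scale1r big1 ?addr0 // => i ia.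
  by rewrite ffunE (negPf ia) linear0.
rewrite scaler0 na0mul addr0 scaler0 big1 // => i _; apply: rsym_high.
exact: leq_trans (msize_model_gen K a i) _.
Qed.

Lemma koszul_inv_gen N a : koszul_inv N.+1 (model_gen a) = x a.
Proof.
rewrite /koszul_inv big_ord_recl symm_gen scale1r big1 ?addr0 // => m _.
by rewrite symm_gen scaler0.
Qed.

Lemma koszul_inv_gen2 N a b :
  koszul_inv N.+2 (mulX b (model_gen a) - mulX a (model_gen b)) = x a ** x b.
Proof.
have E m : symm x m (mulX b (model_gen a) - mulX a (model_gen b)) =
    if m is 1 then 2%:R *: (x a ** x b) else 0.
  rewrite linearB /=; case: m => [|[|m]]; rewrite ?symm0_mulX ?symm_mulX_gen ?subrr //.
  by rewrite (lie_mulC (x b)) opprK scaler_nat mulr2n.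
rewrite /koszul_inv !big_ord_recl !E /= scaler0 add0r scalerA [_ * _]divfK ?natK0 //.
rewrite scale1r big1 ?addr0 // => m _.
by rewrite E scaler0.
Qed.

End LieSymmetrization.

(** * The algebra structure on W (x) S(W) *)

Section ModelAlgebra.
Variables (K : fieldType) (d : nat).

Local Notation model := (model K d).
Implicit Types (u v w : model) (f : {mpoly K[d]}).

Definition linear_part w : {mpoly K[d]} := \sum_i (w i)@_0%MM *: 'X_i.

Fact linear_part_is_linear : linear linear_part.
Proof.
move=> c u w; rewrite /linear_part scaler_sumr -big_split; apply: eq_bigr => i _ /=.
by rewrite !ffunE mcoeffD mcoeffZ scalerDl scalerA.
Qed.

HB.instance Definition _ :=
  GRing.isLinear.Build K model {mpoly K[d]} _ linear_part linear_part_is_linear.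

(** The product of the relatively free algebra of [varL]: x (y z) = 0 kills all but the
    linear part of the right factor, and by right symmetry its letters commute with
    those that already multiply the first letter of the left one. *)
Definition model_mul u v : model := [ffun i => linear_part v * u i].

Fact model_mulDl u v w : model_mul (u + v) w = model_mul u w + model_mul v w.
Proof. by apply/ffunP => i; rewrite !ffunE mulrDr. Qed.

Fact model_mulDr u v w : model_mul u (v + w) = model_mul u v + model_mul u w.
Proof. by apply/ffunP => i; rewrite !ffunE linearD mulrDl. Qed.

Fact model_mulZl (c : K) u v : model_mul (c *: u) v = c *: model_mul u v.
Proof. by apply/ffunP => i; rewrite !ffunE scalerAr. Qed.

Fact model_mulZr (c : K) u v : model_mul u (c *: v) = c *: model_mul u v.
Proof. by apply/ffunP => i; rewrite !ffunE linearZ /= scalerAl. Qed.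

HB.instance Definition _ := Lmodule_isNAAlgebra.Build K model
  model_mulDl model_mulDr model_mulZl model_mulZr.

Lemma model_mulE u v i : (u ** v) i = linear_part v * u i.
Proof. by rewrite ffunE. Qed.

Lemma linear_part_mul u v : linear_part (u ** v) = 0.
Proof.
rewrite /linear_part big1 // => i _; rewrite model_mulE rmorphM /=.
rewrite raddf_sum /= big1 ?mul0r ?scale0r // => j _.
by rewrite mcoeffZ mcoeff0_X mulr0.
Qed.

Lemma model_varL : varL model.
Proof.
apply/varLP; split=> u v w; apply/ffunP => i; rewrite !model_mulE.
  by rewrite linear_part_mul mul0r ffunE.
by rewrite mulrCA.
Qed.

Lemma linear_part_gen j : linear_part (model_gen j) = 'X_j.
Proof.
rewrite /linear_part (bigD1 j) //= ffunE eqxx mcoeff1 eqxx scale1r big1 ?addr0 //.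
by move=> i ij; rewrite ffunE (negPf ij) mcoeff0 scale0r.
Qed.

Lemma linear_part_gl g w : linear_part (gl_model g w) = msubst g (linear_part w).
Proof.
rewrite /linear_part linear_sum /=.
under [RHS]eq_bigr do rewrite linearZ /= msubstX scaler_sumr.
rewrite exchange_big; apply: eq_bigr => i _ /=.
rewrite ffunE raddf_sum scaler_suml; apply: eq_bigr => j _ /=.
by rewrite mcoeffZ mcoeff0_msubst scalerA mulrC.
Qed.

Lemma gl_model_mul g u v :
  gl_model g (u ** v) = gl_model g u ** gl_model g v.
Proof.
apply/ffunP => i; rewrite model_mulE linear_part_gl !ffunE mulr_sumr.
by apply: eq_bigr => j _; rewrite model_mulE rmorphM scalerAr.
Qed.

Lemma gl_model_gen (g : 'M[K]_d) j :
  gl_model g (model_gen j) = \sum_i g i j *: model_gen i.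
Proof.
apply/ffunP => i; rewrite ffunE sum_ffunE (bigD1 j) //= [RHS](bigD1 i) //=.
rewrite !ffunE !eqxx (rmorph1 (msubst g)) !big1 // => [l li|l lj].
  by rewrite !ffunE eq_sym (negPf li) scaler0.
by rewrite ffunE (negPf lj) raddf0 scaler0.
Qed.

End ModelAlgebra.

(** * Symmetrization inverts evaluation in the model *)

Section ModelExpansion.
Variables (K : fieldType) (charK : [pchar K] =i pred0) (d : nat).
Local Notation model := (model K d).
Implicit Types (v w : model) (f : {mpoly K[d]}).

Lemma rsym_monomial m v mu :
  rsym model_gen m v 'X_[mu] =
  if mdeg mu == m then [ffun i => 'X_[mu] * v i] else 0.
Proof.
elim: m mu => [|m IHm] mu.
  rewrite rsym0 mcoeffX mdeg_eq0; case: eqP => [->|_]; last by rewrite scale0r.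
  by rewrite scale1r; apply/ffunP => i; rewrite ffunE mpolyX0 mul1r.
rewrite rsym_rec.
have E k : rsym model_gen m v 'X_[mu]^`M(k) ** model_gen k =
    (mu k)%:R *: if mdeg mu == m.+1 then [ffun i => 'X_[mu] * v i] else 0.
  rewrite mderivX linearZ /= namulZl IHm; case: (posnP (mu k)) => [->|mu_k].
    by rewrite !scale0r.
  have le_k: (U_(k) <= mu)%MM by rewrite lep1mP -lt0n.
  have dE: mdeg mu = (mdeg (mu - U_(k))%MM).+1.
    by rewrite -{1}(submK le_k) mdegD mdeg1 addn1.
  rewrite dE eqSS; case: eqP => _; last by rewrite na0mul.
  congr (_ *: _); apply/ffunP => i; rewrite model_mulE linear_part_gen !ffunE.
  by rewrite mulrA -mpolyXD addmC submK.
under eq_bigr do rewrite E.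
rewrite -scaler_suml scalerA -natr_sum -mdegE; case: eqP => [->|_]; last first.
  by rewrite scaler0.
by rewrite mulVf ?scale1r //; have /pcharf0P -> := charK.
Qed.

Lemma sum_rsym N v f : (msize f <= N)%N ->
  \sum_(m < N) rsym model_gen m v f = [ffun i => f * v i].
Proof.
move=> fN; under eq_bigr do rewrite {1}[f]mpolyE linear_sum.
rewrite exchange_big /=; apply/ffunP => i; rewrite sum_ffunE ffunE.
rewrite {3}[f]mpolyE mulr_suml; apply: eq_big_seq => mu mu_f.
have muN : (mdeg mu < N)%N by apply: leq_trans fN; apply: msize_mdeg_lt.
rewrite (bigD1 (Ordinal muN)) //= linearZ /= rsym_monomial eqxx.
rewrite big1 ?addr0 => [|m m_mu]; first by rewrite !ffunE scalerAl.
rewrite linearZ /= rsym_monomial ifN ?scaler0 //.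
by apply: contra m_mu => /eqP E; apply/eqP/val_inj.
Qed.

(** Symmetrization in the model itself is the projection to one homogeneous
    component: the model does not see the order of the letters after the first.
    Summing up all degrees recovers the element. *)
Lemma sum_symm N w : (forall i, msize (w i) <= N)%N ->
  \sum_(m < N) symm model_gen m w = w.
Proof.
move=> wN; rewrite /symm exchange_big /=.
under eq_bigr do rewrite sum_rsym //.
apply/ffunP => i; rewrite sum_ffunE (bigD1 i) //= !ffunE eqxx mulr1.
by rewrite big1 ?addr0 // => j ji; rewrite !ffunE eq_sym (negPf ji) mulr0.
Qed.

End ModelExpansion.

(** * Lie monomials in the model and the Koszul complex *)

Fixpoint leaves (T : Type) (t : magma T) : nat :=
  if t is Node s t then (leaves s + leaves t)%N else 1%N.

Section LieModel.
Variables (K : fieldType) (charK : [pchar K] =i pred0) (d : nat).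
Local Notation model := (model K d).
Local Notation lie_model := (commutator_algebra model).
Local Notation phi := (magma_eval (model_gen : 'I_d -> lie_model)).
Implicit Types (s t : magma 'I_d).

Lemma lie_modelE s t i : phi (Node s t) i =
  linear_part (phi t) * phi s i - linear_part (phi s) * phi t i.
Proof. by rewrite /= !ffunE. Qed.

Lemma linear_part_node s t : linear_part (phi (Node s t)) = 0.
Proof. by rewrite linearB /= !linear_part_mul subrr. Qed.

(** The Lie subalgebra of the model generated by W lies in the set where the Koszul
    differential equals the linear part, hence consists of Koszul cycles in
    degrees at least 2. *)
Lemma koszul_phi t : koszul (phi t) = linear_part (phi t).
Proof.
elim: t => [a|s IHs t IHt].
  rewrite linear_part_gen /koszul (bigD1 a) //= ffunE eqxx mulr1.
  by rewrite big1 ?addr0 // => i ia; rewrite ffunE (negPf ia) mulr0.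
rewrite linear_part_node /koszul.
under eq_bigr do rewrite lie_modelE mulrBr mulrCA [_ * (linear_part (phi s) * _)]mulrCA.
by rewrite sumrB -!mulr_sumr -!/(koszul _) IHs IHt mulrC subrr.
Qed.

(** Since a bracket of two brackets vanishes on both sides, only brackets with a
    generator need an argument; they are covered by [koszul_inv_mulX], started at
    the bracket of two generators, which is no multiple of a Koszul cycle of lower
    degree. *)
Lemma koszul_inv_phi (A : naalgType K) (LA : metabelianLie A) (x : 'I_d -> A) N t :
  (leaves t <= N)%N -> koszul_inv x N (phi t) = magma_eval x t.
Proof.
have [_ _ met] := proj1 (metabelianLieP A) LA.
have node_leaf s1 s2 b M : koszul_inv x M (phi (Node s1 s2)) = magma_eval x (Node s1 s2) ->
    koszul_inv x M.+1 (mulX b (phi (Node s1 s2))) = magma_eval x (Node (Node s1 s2) (Leaf b)).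
  move=> IH; rewrite (koszul_inv_mulX charK LA) ?IH //.
  by rewrite koszul_phi linear_part_node.
elim: t N => [a|[a|s1 s2] IHs [b|t1 t2] IHt] N.
- by case: N => // N _; rewrite /= koszul_inv_gen.
- case: N => [|[|N]] // _.
  rewrite -[RHS](koszul_inv_gen2 charK LA x N); congr koszul_inv.
  by apply/ffunP => i; rewrite lie_modelE !ffunE !linear_part_gen.
- case: N => [|N]; rewrite -[leaves _]/(1 + leaves (Node t1 t2))%N add1n // ltnS => leN.
  rewrite [RHS](lie_mulC LA (x a)) -[X in _ = - X]/(magma_eval x (Node (Node t1 t2) (Leaf a))).
  rewrite -(node_leaf t1 t2 a N) ?IHt //.
  rewrite -linearN; congr koszul_inv; apply/ffunP => i.
  by rewrite lie_modelE linear_part_gen linear_part_node mul0r sub0r !ffunE.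
- case: N => [|N]; rewrite -[leaves _]/(leaves (Node s1 s2) + 1)%N addn1 // ltnS => leN.
  rewrite -(node_leaf s1 s2 b N) ?IHs //; congr koszul_inv; apply/ffunP => i.
  by rewrite lie_modelE linear_part_gen linear_part_node mul0r subr0 !ffunE.
move=> _; rewrite [RHS]met; apply: etrans (linear0 (koszul_inv x N)).
congr koszul_inv; apply/ffunP => i.
by rewrite lie_modelE !linear_part_node !mul0r subr0 ffunE.
Qed.

End LieModel.

(** * Homomorphisms from relatively free algebras *)

Section FreeAlgebra.
Import monalg.
Variables (K : fieldType) (d : nat).

Lemma free_mulU (s t : magma 'I_d) :
  free_mul (mkmalgU s 1 : freeNA K 'I_d) (mkmalgU t 1) =
  mkmalgU (Node s t) 1.
Proof. exact: etrans (lextU _ _) (lextU _ _). Qed.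

Lemma malgU_scale (T : choiceType) (c : K) (t : T) :
  c *: (mkmalgU t 1 : malg T K) = mkmalgU t c.
Proof.
by apply/malgP => s; rewrite mcoeffZ !mcoeffU mulr_natr.
Qed.

Lemma magma_eval_free_var (t : magma 'I_d) :
  magma_eval (@free_var K 'I_d) t = mkmalgU t 1.
Proof.
elim: t => [//|s IHs t IHt].
exact: etrans (congr2 (@free_mul K 'I_d) IHs IHt) (free_mulU s t).
Qed.

Lemma na_eval_free_var (p : freeNA K 'I_d) : na_eval (@free_var K 'I_d) p = p.
Proof.
rewrite [RHS]monalgE /na_eval lextE; apply: eq_bigr => t _.
by rewrite magma_eval_free_var; exact: malgU_scale.
Qed.

End FreeAlgebra.

Section RelativelyFreeMaps.
Variables (K : fieldType) (d : nat).

Lemma relfree_pi_mul (V : naalgType K -> Prop) (p q : freeNA K 'I_d) :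
  relfree_pi V (p ** q) = relfree_pi V p ** relfree_pi V q.
Proof. exact: relfree_piM. Qed.

Lemma relfree_pi_eval (V : naalgType K -> Prop) (p : freeNA K 'I_d) :
  relfree_pi V p = na_eval (@relfree_gen K V d) p.
Proof.
rewrite -{1}[p]na_eval_free_var (na_eval_hom _ _ (@relfree_piM K V d)).
exact: na_eval_eq.
Qed.

(** Substituting elements of the free algebra of rank [d] in an identity of the variety gives an
    identity again, so the relatively free algebra lies in its own variety. *)
Lemma relfree_variety (S : set (freeNA K nat)) :
  variety_of S (relfree (variety_of S) d).
Proof.
move=> p Sp a; pose b n := repr (a n).
rewrite (na_eval_eq p (fun n => esym (relfree_reprK (a n)))).
rewrite -(na_eval_hom b p (@relfree_piM K (variety_of S) d)).
rewrite -(linear0 (@relfree_pi K (variety_of S) d)); apply/relfree_piP.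
rewrite subr0; apply/identitiesP => A VA c.
by rewrite (na_eval_hom b p (na_evalM c)) VA.
Qed.

Section Evaluation.
Variables (V : naalgType K -> Prop) (A : naalgType K) (VA : V A) (a : 'I_d -> A).

Definition relfree_eval (u : relfree V d) : A := na_eval a (repr u).

Lemma relfree_evalE p : relfree_eval (relfree_pi V p) = na_eval a p.
Proof.
have /relfree_piP/identitiesP/(_ A VA a) := relfree_reprK (relfree_pi V p).
by rewrite na_evalB => /eqP; rewrite subr_eq0 => /eqP.
Qed.

Fact relfree_eval_is_linear : linear relfree_eval.
Proof.
move=> c u v; rewrite -[u]relfree_reprK -[v]relfree_reprK -linearP.
by rewrite !relfree_evalE linearP.
Qed.

Lemma relfree_evalM : {morph relfree_eval : u v / u ** v}.
Proof.
move=> u v; rewrite -[u]relfree_reprK -[v]relfree_reprK -relfree_pi_mul.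
by rewrite !relfree_evalE na_evalM.
Qed.

Lemma relfree_eval_gen i : relfree_eval (@relfree_gen K V d i) = a i.
Proof. by rewrite relfree_evalE na_eval_var. Qed.

End Evaluation.

Lemma GL_act_pi (V : naalgType K -> Prop) g p :
  GL_act g (relfree_pi V p) = na_eval (fun j => \sum_i g i j *: @relfree_gen K V d i) p.
Proof. exact: relfree_substE. Qed.

Fact GL_act_is_linear (V : naalgType K -> Prop) g :
  linear (GL_act g : relfree V d -> relfree V d).
Proof.
move=> c u v; rewrite -[u]relfree_reprK -[v]relfree_reprK -linearP.
by rewrite !GL_act_pi linearP.
Qed.

HB.instance Definition _ (V : naalgType K -> Prop) g :=
  GRing.isLinear.Build K (relfree V d) (relfree V d) _ (GL_act g)
    (@GL_act_is_linear V g).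

Lemma GL_actM (V : naalgType K -> Prop) g :
  {morph (GL_act g : relfree V d -> relfree V d) : u v / u ** v}.
Proof.
move=> u v; rewrite -[u]relfree_reprK -[v]relfree_reprK -relfree_pi_mul.
by rewrite !GL_act_pi na_evalM.
Qed.

Lemma GL_act_gen (V : naalgType K -> Prop) g j :
  GL_act g (@relfree_gen K V d j) = \sum_i g i j *: @relfree_gen K V d i.
Proof. by rewrite GL_act_pi na_eval_var. Qed.

End RelativelyFreeMaps.

(** * Invariants *)

Section Subspaces.
Variables (K : fieldType) (d : nat).

Lemma subspace_invariants (V : naalgType K -> Prop) (G : set 'M[K]_d) :
  is_subspace (invariants V G).
Proof.
split=> [g _|u v Gu Gv g Gg|c u Gu g Gg]; first exact: linear0.
- by rewrite linearD; congr (_ + _); [apply: Gu | apply: Gv].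
- by rewrite linearZ; congr (_ *: _); apply: Gu.
Qed.

Lemma subalgebra_invariants (V : naalgType K -> Prop) (G : set 'M[K]_d) :
  is_subalgebra (invariants V G).
Proof.
split; first exact: subspace_invariants.
by move=> u v Gu Gv g Gg; rewrite GL_actM; congr (_ ** _); [apply: Gu | apply: Gv].
Qed.

End Subspaces.

Lemma subspace_span (K : fieldType) (A : naalgType K) (S : set A) :
  is_subspace (smallest (@is_subspace K A) S).
Proof.
split=> [B [[B0 _ _] _]|u v Su Sv B BS|c u Su B BS] //.
- by case: (BS) => [[_ BD _] _]; apply: BD; [apply: Su | apply: Sv].
- by case: (BS) => [[_ _ BZ] _]; apply: BZ; apply: Su.
Qed.

Section Invariants.
Variables (K : fieldType) (charK : [pchar K] =i pred0) (d : nat).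
Variables (V : naalgType K -> Prop) (VL : forall A : naalgType K, varL A -> V A).
Variables (G : set 'M[K]_d) (G0 : linear_invariants G = [set 0]).
Local Notation lie_model := (commutator_algebra (model K d)).

Let LM : metabelianLie lie_model := commutator_metabelianLie (@model_varL K d).
Let VM : V (model K d) := VL (@model_varL K d).

Definition to_model : relfree V d -> model K d := relfree_eval (@model_gen K d).
HB.instance Definition _ := GRing.isLinear.Build K (relfree V d) (model K d) _
  to_model (relfree_eval_is_linear VM _).

Definition lie_to_model : relfree (@metabelianLie K) d -> lie_model :=
  relfree_eval (model_gen : 'I_d -> lie_model).
HB.instance Definition _ := GRing.isLinear.Build K (relfree (@metabelianLie K) d)
  lie_model _ lie_to_model (relfree_eval_is_linear LM _).

Lemma relfree_lie : metabelianLie (relfree (@metabelianLie K) d).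
Proof. exact: relfree_variety. Qed.

Lemma to_modelM u v : to_model (u ** v) = to_model u ** to_model v.
Proof. exact: (relfree_evalM VM). Qed.

Lemma to_model_GL g u : to_model (GL_act g u) = gl_model g (to_model u).
Proof.
rewrite -[u]relfree_reprK GL_act_pi.
rewrite (na_eval_hom (h := to_model) _ _ to_modelM).
rewrite /to_model (relfree_evalE VM).
rewrite (na_eval_hom (h := gl_model g : {linear model K d -> model K d}) _ _ (gl_model_mul g)).
apply: na_eval_eq => j; rewrite [RHS]gl_model_gen linear_sum; apply: eq_bigr => i _.
by rewrite linearZ /= /to_model (relfree_eval_gen VM).
Qed.

Lemma lie_to_modelM u v : lie_to_model (u ** v) = lie_to_model u ** lie_to_model v.
Proof. exact: (relfree_evalM LM). Qed.

Lemma lie_to_model_GL g u : lie_to_model (GL_act g u) = gl_model g (lie_to_model u).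
Proof.
have glM : {morph (gl_model g : lie_model -> lie_model) : u v / u ** v}.
  by move=> v w; rewrite !commutatorE linearB; congr (_ - _); exact: gl_model_mul.
rewrite -[u]relfree_reprK GL_act_pi.
rewrite (na_eval_hom (h := lie_to_model) _ _ lie_to_modelM).
rewrite /lie_to_model (relfree_evalE LM).
rewrite (na_eval_hom (h := gl_model g : {linear lie_model -> lie_model}) _ _ glM).
apply: na_eval_eq => j; rewrite [RHS]gl_model_gen linear_sum; apply: eq_bigr => i _.
by rewrite linearZ /= /lie_to_model (relfree_eval_gen LM).
Qed.

Lemma symm_GL (W : naalgType K -> Prop) g m w :
  GL_act g (symm (@relfree_gen K W d) m w) = symm (@relfree_gen K W d) m (gl_model g w).
Proof. by apply: symm_morph; [exact: GL_actM | exact: GL_act_gen]. Qed.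

(** The linear part of an invariant is fixed by [G], hence zero, and products in the
    model only depend on the linear part of the right factor. *)
Lemma to_model_mul_invariant u v : invariants V G v -> to_model (u ** v) = 0.
Proof.
move=> Gv; pose c : 'cV[K]_d := \col_j (to_model v j)@_0%MM.
have c0 : c = 0.
  have : linear_invariants G c; last by rewrite G0.
  move=> g Gg; apply/colP => i; rewrite !mxE.
  rewrite -[in RHS](Gv g Gg) to_model_GL ffunE raddf_sum; apply: eq_bigr => j _ /=.
  by rewrite mxE mcoeffZ mcoeff0_msubst.
rewrite to_modelM; apply/ffunP => i; rewrite model_mulE ffunE.
rewrite /linear_part big1 ?mul0r // => j _.
by have /colP/(_ j) := c0; rewrite !mxE => ->; rewrite scale0r.
Qed.

(** Symmetrization in F_d(V) splits the map to the model and commutes with [G],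
    which makes the map surjective on invariants with no averaging over [G]. *)
Lemma lift_invariant u : invariants (@metabelianLie K) G u ->
  exists2 v, invariants V G v & to_model v = lie_to_model u.
Proof.
move=> Gu; pose w : model K d := lie_to_model u.
have [N wN] : exists N, forall i, (msize (w i) <= N)%N.
  by exists (\max_i msize (w i))%N => i; apply: leq_bigmax.
exists (\sum_(m < N) symm (@relfree_gen K V d) m w).
  move=> g Gg; rewrite linear_sum; apply: eq_bigr => m _ /=.
  by rewrite symm_GL /w -lie_to_model_GL Gu.
rewrite -[RHS](sum_symm charK wN) linear_sum; apply: eq_bigr => m _ /=.
rewrite -[RHS]/(symm model_gen m w) -[in RHS](gl_model1 w).
apply: symm_morph => [|j]; first exact: to_modelM.
rewrite [LHS](relfree_eval_gen VM) (bigD1 j) //= mxE eqxx scale1r.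
by rewrite big1 ?addr0 // => i ij; rewrite mxE (negPf ij) scale0r.
Qed.

Local Notation lie_gen := (@relfree_gen K (@metabelianLie K) d).

(** The truncation [N] must reach the degree of [u]; beyond it nothing changes. *)
Lemma koszul_inv_lie_to_model u :
  exists N0, forall N, (N0 <= N)%N -> koszul_inv lie_gen N (lie_to_model u) = u.
Proof.
rewrite -[u]relfree_reprK; set p := repr u.
exists (\sum_(t <- finmap.enum_fset (monalg.msupp p)) leaves t)%N => N pN.
rewrite /lie_to_model (relfree_evalE LM) relfree_pi_eval /na_eval !lextE linear_sum.
apply: eq_big_seq => t t_p /=; rewrite linearZ /= (koszul_inv_phi charK relfree_lie) //.
apply: leq_trans pN; rewrite (big_rem t) //=; exact: leq_addr.
Qed.

(** The left inverse of [lie_to_model], composed with [to_model], maps F_d(V)^G onto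
    F_d(A^2)^G and kills products, so the images of algebra generators span. *)
Lemma finite_lie_invariants : finitely_generated (invariants V G) ->
  exists s : seq (relfree (@metabelianLie K) d),
    invariants (@metabelianLie K) G = smallest (@is_subspace K _) [set` s].
Proof.
case=> s sE.
(* A degree bound for the generators bounds all invariants: products vanish in
   the model. *)
have [N sN] : exists N, forall v, v \in s -> forall i, (msize (to_model v i) <= N)%N.
  exists (\sum_(v <- s) \max_i msize (to_model v i))%N => v vs i.
  rewrite (big_rem v) //=; apply: leq_trans (leq_addr _ _).
  exact: (leq_bigmax i).
pose T v := koszul_inv lie_gen N (to_model v).
have TGL g v : GL_act g (T v) = T (GL_act g v).
  rewrite /T to_model_GL /koszul_inv linear_sum; apply: eq_bigr => m _ /=.
  by rewrite linearZ /= symm_GL.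
have sG v : v \in s -> invariants V G v.
  by move=> vs; rewrite sE; apply: sub_gen_smallest.
exists (map T s); apply/seteqP; split; last first.
  apply: smallest_sub; first exact: subspace_invariants.
  move=> _ /= /mapP[v vs ->] g Gg; rewrite TGL; congr T; exact: sG.
move=> u Gu; have [v Gv vu] := lift_invariant Gu.
pose S := smallest (@is_subspace K _) [set` map T s].
have [S0 SD SZ] : is_subspace S by exact: subspace_span.
pose B : set (relfree V d) := [set v | [/\ invariants V G v, S (T v)
  & forall i, (msize (to_model v i) <= N)%N]].
have : B v.
  have := Gv; rewrite sE; apply: smallest_sub; last first.
    move=> w /= ws; split; [exact: sG | | exact: sN].
    by apply: sub_gen_smallest => /=; apply: map_f.
  have [[G0' GD GZ] GM] := subalgebra_invariants V G.
  split; first split.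
  - split=> //; first by rewrite /T !linear0.
    by move=> i; rewrite linear0 ffunE msize0.
  - move=> w1 w2 [Gw1 Sw1 Nw1] [Gw2 Sw2 Nw2]; split; first exact: GD.
      by rewrite /T !linearD; apply: SD.
    move=> i; rewrite linearD ffunE; apply: leq_trans (msizeD_le _ _) _.
    by rewrite geq_max Nw1 Nw2.
  - move=> c w [Gw Sw Nw]; split; first exact: GZ.
      by rewrite /T !linearZ; apply: SZ.
    by move=> i; rewrite linearZ ffunE; apply: leq_trans (msizeZ_le _ _) _.
  move=> w1 w2 [Gw1 _ _] [Gw2 _ _].
  split; first exact: GM.
    by rewrite /T to_model_mul_invariant // linear0.
  by move=> i; rewrite to_model_mul_invariant // ffunE msize0.
case=> _ STv Nv; suff <- : T v = u by [].
have [N0 uN0] := koszul_inv_lie_to_model u.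
(* The truncation at [N] and the one depending on [u] agree, as [lie_to_model u]
   has degree below [N]. *)
rewrite -[RHS](uN0 (maxn N N0)) ?leq_maxr // /T vu; symmetry.
by apply: koszul_inv_high; rewrite ?leq_maxl // -vu.
Qed.

End Invariants.

Theorem corollary2p4 (K : fieldType) (charK : [pchar K] =i pred0)
    (d : nat) (d_ge2 : (2 <= d)%N)
    (G : set 'M[K]_d) (subG : GL_subgroup G) :
  linear_invariants G = [set 0] ->
  infinite_dim (invariants (@metabelianLie K) G) ->
  forall V : naalgType K -> Prop, is_variety V ->
    (forall A : naalgType K, @varL K A -> V A) ->
    ~ finitely_generated (invariants V G).
Proof.
move=> G0 Ginf V _ VL Gfin; apply: Ginf.
exact: (finite_lie_invariants charK VL G0 Gfin).
Qed.
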